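(* Let $P=(p_1,p_2,\dots)$ be a properly arranged sequence and let $\sum_{(P,P)}$ be the $2$-solenoid of the sequence of matrices $\big(\mathrm{diag}(p_j,p_j)\big)_{j\ge1}$. Whenever two linear flows $\Phi^{\mathbf\omega}$ and $\Phi^{\mathbf\omega'}$ on $\sum_{(P,P)}$ ($\mathbf\omega,\mathbf\omega'\in\mathbb R^2-\{\mathbf 0\}$) are equivalent, there is an invertible matrix $A=\begin{pmatrix}a&b\\c&d\end{pmatrix}$ such that all entries of $A$ and of $A^{-1}$ are proper $P\to P$ multipliers, $A$ represents an automorphism $A_{P\times P}$ of $\sum_{(P,P)}$, and $\alpha\times A_{P\times P}$ is an equivalence from $\Phi^{\mathbf\omega}$ to $\Phi^{\mathbf\omega'}$ for some increasing continuous homomorphism $\alpha:\mathbb R\to\mathbb R$. In particular, all rational linear flows on $\sum_{(P,P)}$ are equivalent to one another.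
   Context: All homomorphisms of topological groups are continuous. $S^1=\mathbb R/\mathbb Z$, $\mathbf T^n=\prod_{i=1}^nS^1$, $p^n:\mathbb R^n\to\mathbf T^n$ is coordinatewise reduction mod $1$. $n$-solenoid: for a sequence $\overline M=(M_1,M_2,\dots)$ of $n\times n$ integer matrices with non-zero determinants, $\sum_{\overline M}=\{(\mathbf x^j)_{j\ge1}\in\prod_{j=1}^\infty\mathbf T^n:\mathbf x^j=f_j^{j+1}(\mathbf x^{j+1})\ \forall j\}$, where $f_j^{j+1}\circ p^n=p^n\circ M_j$; it is a topological group. $\pi_{\overline M}:\mathbb R^n\to\sum_{\overline M}$ is $\mathbf t\mapsto(p^n(\mathbf t),p^n(M_1^{-1}\mathbf t),\dots,p^n(M_j^{-1}\cdots M_1^{-1}\mathbf t),\dots)$. A matrix $A$ represents an automorphism $h$ of $\sum_{\overline M}$ if $h\circ\pi_{\overline M}=\pi_{\overline M}\circ A$ (such $h$ is unique; here it is denoted $A_{P\times P}$). For a sequence $P=(p_1,p_2,\dots)$ of non-zero integers, $\sum_P$, $\pi_P$ denote the case $n=1$, $M_j=(p_j)$; $\mathbf C_P=\pi_P(\mathbb R)$ is the path component of the identity of $\sum_P$, with the subspace topology. Linear flows: $\Phi^{\mathbf\omega}(t,x)=\pi_{\overline M}(t\mathbf\omega)+x$. For $\mathbf\omega=(\omega_1,\omega_2)$, the flow is irrational if $\omega_1,\omega_2$ are rationally independent ($k_1\omega_1+k_2\omega_2=0$ with integers $k_1,k_2$ implies $k_1=k_2=0$) and rational otherwise. Equivalence: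 flows $\phi$ on $X$ and $\psi$ on $Y$ are equivalent if there are an increasing homomorphism $\alpha:\mathbb R\to\mathbb R$ and a homeomorphism $h:X\to Y$ with $h(\phi(t,x))=\psi(\alpha(t),h(x))$ for all $t,x$; then $\alpha\times h$ is called an equivalence from $\phi$ to $\psi$. Proper multipliers: for $r\in\mathbb R$ define $r^{P\to Q}:\mathbf C_P\to\mathbf C_Q$ by $r^{P\to Q}(\pi_P(s))=\pi_Q(rs)$ for $s\in\mathbb R$ if $P$ is not eventually $1$; if $P$ is eventually $1$ and $p$ is the product of all its terms, then $\pi_P:[0,p)\to\mathbf C_P$ is a bijection and $r^{P\to Q}(\pi_P(s))=\pi_Q(rs)$ for $s\in[0,p)$. $r$ is a proper $P\to Q$ multiplier if $r^{P\to Q}$ is a continuous homomorphism. Properly arranged (single sequence, equivalently the pair $P,P$): let $f_0(k,i)=\frac{(k+i-2)(k+i-1)}2+i$, a bijection $\mathbb N\times\mathbb N\to\mathbb N$ with $\mathbb N=\{1,2,\dots\}$. $P$ is properly arranged if for every $k$, with $\ell_k$ the $k$-th prime, there is $\mu_k\in\{0,1,2,\dots\}\cup\{\infty\}$ such that $p_{f_0(k,i)}=\ell_k$ for $i\le\mu_k$ and $p_{f_0(k,i)}=1$ for $i>\mu_k$. *)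

(* Defs.v *)
From HB Require Import structures.
From mathcomp Require Import all_boot all_order all_algebra.
From mathcomp Require Import generic_quotient ring_quotient.
From mathcomp Require Import all_classical all_reals all_analysis.
Set Implicit Arguments.
Unset Strict Implicit.
Unset Printing Implicit Defensive.
Import Order.TTheory GRing.Theory Num.Theory.
Import numFieldNormedType.Exports.
Local Open Scope classical_set_scope.
Local Open Scope ring_scope.

Definition integers (R : realType) : {pred R} := [pred x | x \is a Num.int].

Fact integers_zmod_closed (R : realType) : zmod_closed (@integers R).
Proof. by split=> [|x y]; rewrite !inE; [exact: rpred0|exact: rpredB]. Qed.

HB.instance Definition _ (R : realType) :=
  GRing.isZmodClosed.Build R (@integers R) (@integers_zmod_closed R).

(* [Quotient.quot] carries the quotient group structure and
   [quotient_topology] the quotient topology. *)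
Definition circle (R : realType) : Type :=
  quotient_topology (Quotient.quot (@integers R)).

HB.instance Definition _ (R : realType) := Topological.on (circle R).
HB.instance Definition _ (R : realType) := Quotient.on (circle R).
HB.instance Definition _ (R : realType) :=
  GRing.isZmodule.Build (circle R)
    (@Quotient.addqA R (@integers R)) (@Quotient.addqC R (@integers R))
    (@Quotient.add0q R (@integers R)) (@Quotient.addNq R (@integers R)).

Definition circle_proj (R : realType) (x : R) : circle R :=
  (\pi_(circle R) x)%qT.

Fact circle_proj_is_zmod_morphism (R : realType) :
  zmod_morphism (@circle_proj R).
Proof.
exact: (@pi_is_zmod_morphism _ _ _ (Quotient.quot (@integers R))).
Qed.

HB.instance Definition _ (R : realType) :=
  GRing.isZmodMorphism.Build R (circle R) (@circle_proj R)
    (@circle_proj_is_zmod_morphism R).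

Lemma circle_projP (R : realType) (x y : R) :
  circle_proj x = circle_proj y <-> exists k : int, x - y = k%:~R.
Proof.
have E := Quotient.idealrBE (@integers R) x y.
split=> [xy|/intrP xy].
  apply/intrP; suff : x - y \in @integers R by rewrite inE.
  by rewrite E; apply/eqP; exact: xy.
have : x - y \in @integers R by rewrite inE.
by rewrite E => /eqP.
Qed.

(* Points of T^n and vectors of R^n are columns. *)
Notation torus R n := 'cV[circle R]_n.

Definition torus_proj (R : realType) n (v : 'cV[R]_n) : torus R n :=
  map_mx (@circle_proj R) v.

Fact torus_proj_is_zmod_morphism (R : realType) n :
  zmod_morphism (@torus_proj R n).
Proof. exact: raddfB. Qed.

HB.instance Definition _ (R : realType) n :=
  GRing.isZmodMorphism.Build 'cV[R]_n (torus R n) (@torus_proj R n)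
    (@torus_proj_is_zmod_morphism R n).

Definition torus_map (R : realType) n (M : 'M[int]_n) (x : torus R n) :
    torus R n :=
  \col_i \sum_j (x j 0 *~ M i j).

Lemma torus_map_proj (R : realType) n (M : 'M[int]_n) (v : 'cV[R]_n) :
  torus_map M (torus_proj v) = torus_proj (map_mx intr M *m v).
Proof.
apply/colP => i; rewrite !mxE raddf_sum; apply: eq_bigr => j _.
by rewrite !mxE mulrzl raddfMz.
Qed.

Fact torus_map_is_zmod_morphism (R : realType) n (M : 'M[int]_n) :
  zmod_morphism (@torus_map R n M).
Proof.
move=> x y; apply/colP => i; rewrite !mxE -sumrB; apply: eq_bigr => j _.
by rewrite !mxE mulrzBl.
Qed.

HB.instance Definition _ (R : realType) n (M : 'M[int]_n) :=
  GRing.isZmodMorphism.Build (torus R n) (torus R n) (@torus_map R n M)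
    (@torus_map_is_zmod_morphism R n M).

Record nonsingular_seq (n : nat) := NonsingularSeq {
  seq_mx :> nat -> 'M[int]_n;
  seq_mx_det : forall j, \det (seq_mx j) != 0 }.

Definition torus_seq (R : realType) (n : nat) : Type :=
  {ptws nat -> torus R n}.
HB.instance Definition _ (R : realType) n := Topological.on (torus_seq R n).
HB.instance Definition _ (R : realType) n :=
  GRing.Zmodule.copy (torus_seq R n) (nat -> torus R n).

Lemma torus_seqB (R : realType) n (x y : torus_seq R n) j :
  (x - y) j = x j - y j.
Proof. by []. Qed.

(* The sequence M_1, M_2, ... is indexed from 0, as are the coordinates. *)
Definition in_solenoid (R : realType) n (M : nonsingular_seq n) :
    {pred torus_seq R n} :=
  [pred x | `[< forall j : nat, x j = torus_map (M j) (x j.+1) >]].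

Arguments in_solenoid R {n} M.

Lemma in_solenoidP (R : realType) n (M : nonsingular_seq n)
    (x : torus_seq R n) :
  reflect (forall j, x j = torus_map (M j) (x j.+1)) (x \in in_solenoid R M).
Proof. exact: asboolP. Qed.

Fact torus_map_seqB (R : realType) n (M : 'M[int]_n) (x y : torus_seq R n) j :
  x j = torus_map M (x j.+1) -> y j = torus_map M (y j.+1) ->
  (x - y) j = torus_map M ((x - y) j.+1).
Proof.
move=> xM yM.
by rewrite !torus_seqB [RHS](raddfB (@torus_map R n M)) /= -xM -yM.
Qed.

Fact in_solenoid_zmod_closed (R : realType) n (M : nonsingular_seq n) :
  zmod_closed (in_solenoid R M).
Proof.
split=> [|x y].
  by apply/in_solenoidP => j; rewrite [RHS](raddf0 (@torus_map R n (M j))).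
move=> /in_solenoidP xM /in_solenoidP yM; apply/in_solenoidP => j.
exact: torus_map_seqB.
Qed.

HB.instance Definition _ (R : realType) n (M : nonsingular_seq n) :=
  GRing.isZmodClosed.Build (torus_seq R n) (in_solenoid R M)
    (@in_solenoid_zmod_closed R n M).

Record solenoid (R : realType) n (M : nonsingular_seq n) := Solenoid {
  sol_val : torus_seq R n;
  sol_valP : sol_val \in in_solenoid R M }.
Arguments solenoid R {n} M.
Arguments sol_val {R n M}.

HB.instance Definition _ (R : realType) n (M : nonsingular_seq n) :=
  [isSub for @sol_val R n M].
HB.instance Definition _ (R : realType) n (M : nonsingular_seq n) :=
  [Choice of solenoid R M by <:].
HB.instance Definition _ (R : realType) n (M : nonsingular_seq n) :=
  [SubChoice_isSubZmodule of solenoid R M by <:].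
HB.instance Definition _ (R : realType) n (M : nonsingular_seq n) :=
  Topological.copy (solenoid R M) (initial_topology (@sol_val R n M)).

(* [sol_lift M t j] is M_j^-1 ... M_1^-1 t. *)
Fixpoint sol_lift (R : realType) n (M : nat -> 'M[int]_n) (t : 'cV[R]_n)
    (j : nat) : 'cV[R]_n :=
  if j is j'.+1 then invmx (map_mx intr (M j')) *m sol_lift M t j' else t.

Fact sol_lift_in (R : realType) n (M : nonsingular_seq n) (t : 'cV[R]_n) :
  ((fun j => torus_proj (sol_lift M t j)) : torus_seq R n)
    \in in_solenoid R M.
Proof.
apply/in_solenoidP => j; rewrite torus_map_proj /= mulmxA mulmxV ?mul1mx //.
by rewrite unitmxE det_map_mx unitfE intr_eq0 seq_mx_det.
Qed.

Definition sol_pi (R : realType) n (M : nonsingular_seq n) (t : 'cV[R]_n) :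
  solenoid R M := Solenoid (sol_lift_in M t).

Fact sol_pi_is_zmod_morphism (R : realType) n (M : nonsingular_seq n) :
  zmod_morphism (@sol_pi R n M).
Proof.
move=> s t; apply: val_inj; rewrite [RHS](raddfB val); apply/funext => j.
rewrite -[RHS]/(torus_proj (sol_lift M s j) - torus_proj (sol_lift M t j)).
rewrite -raddfB; congr torus_proj; elim: j => //= j ->.
by rewrite mulmxBr.
Qed.

HB.instance Definition _ (R : realType) n (M : nonsingular_seq n) :=
  GRing.isZmodMorphism.Build 'cV[R]_n (solenoid R M) (@sol_pi R n M)
    (@sol_pi_is_zmod_morphism R n M).

Record nonzero_seq := NonzeroSeq {
  seq_int :> nat -> int;
  seq_int_neq0 : forall j, seq_int j != 0 }.

Fact scalar_seq_det n (P : nonzero_seq) j : \det ((P j)%:M : 'M[int]_n) != 0.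
Proof. by rewrite det_scalar expf_neq0 // seq_int_neq0. Qed.

Definition scalar_seq n (P : nonzero_seq) : nonsingular_seq n :=
  NonsingularSeq (scalar_seq_det n P).

Definition pi1 (R : realType) (P : nonzero_seq) (s : R) :
  solenoid R (scalar_seq 1 P) := sol_pi (scalar_seq 1 P) s%:M.

Definition in_C (R : realType) (P : nonzero_seq) :
    {pred solenoid R (scalar_seq 1 P)} :=
  [pred x | `[< exists s : R, pi1 P s = x >]].
Arguments in_C R P : clear implicits.

Lemma in_CP (R : realType) (P : nonzero_seq) (x : solenoid R (scalar_seq 1 P)) :
  reflect (exists s : R, pi1 P s = x) (x \in in_C R P).
Proof. exact: asboolP. Qed.

Fact in_C_zmod_closed (R : realType) (P : nonzero_seq) :
  zmod_closed (in_C R P).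
Proof.
split.
  by apply/in_CP; exists 0; rewrite /pi1 (raddf0 (@scalar_mx R 1)) raddf0.
move=> _ _ /in_CP[s <-] /in_CP[t <-]; apply/in_CP.
by exists (s - t); rewrite /pi1 (raddfB (@scalar_mx R 1)) raddfB.
Qed.

HB.instance Definition _ (R : realType) (P : nonzero_seq) :=
  GRing.isZmodClosed.Build (solenoid R (scalar_seq 1 P)) (in_C R P)
    (@in_C_zmod_closed R P).

Record C_ (R : realType) (P : nonzero_seq) := InC {
  C_val : solenoid R (scalar_seq 1 P);
  C_valP : C_val \in in_C R P }.
Arguments C_ R P : clear implicits.
Arguments C_val {R P}.
HB.instance Definition _ (R : realType) (P : nonzero_seq) :=
  [isSub for @C_val R P].
HB.instance Definition _ (R : realType) (P : nonzero_seq) :=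
  [Choice of C_ R P by <:].
HB.instance Definition _ (R : realType) (P : nonzero_seq) :=
  [SubChoice_isSubZmodule of C_ R P by <:].
HB.instance Definition _ (R : realType) (P : nonzero_seq) :=
  Topological.copy (C_ R P) (initial_topology (@C_val R P)).

Fact pi1_in (R : realType) (P : nonzero_seq) (s : R) : pi1 P s \in in_C R P.
Proof. by apply/in_CP; exists s. Qed.

Definition pi_C (R : realType) (P : nonzero_seq) (s : R) : C_ R P :=
  InC (pi1_in P s).

(* When P is eventually 1 from index N on, the product of all its terms is
   the product of the first N. *)
Definition multiplier_dom (R : realType) (P : nonzero_seq) : set R :=
  [set s | forall N : nat, (forall j, (N <= j)%N -> P j = 1) ->
     0 <= s < (\prod_(j < N) P j)%:~R].

Arguments multiplier_dom R P : clear implicits.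

(* [g] is the map r^{P -> Q}: it is determined by this condition as [pi_C]
   maps [multiplier_dom R P] onto [C_ R P]. (The definition is only meant for
   sequences whose product of terms is positive if they are eventually 1.) *)
Definition is_multiplier_map (R : realType) (P Q : nonzero_seq) (r : R)
    (g : C_ R P -> C_ R Q) : Prop :=
  forall s, multiplier_dom R P s -> g (pi_C P s) = pi_C Q (r * s).

Definition proper_multiplier (R : realType) (P Q : nonzero_seq) (r : R) :
    Prop :=
  exists g : C_ R P -> C_ R Q,
    [/\ is_multiplier_map r g, {morph g : x y / x + y} & continuous g].

Definition f0 (k i : nat) : nat :=
  (((k + i - 2) * (k + i - 1)) %/ 2 + i)%N.

Fact next_prime_ex (m : nat) : exists p, (m < p)%N && prime p.
Proof. by have [p mp pp] := prime_above m; exists p; rewrite mp. Qed.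

(* The k-th prime for 1 <= k, with the dummy value 0 at k = 0. *)
Fixpoint kth_prime (k : nat) : nat :=
  if k is k'.+1 then ex_minn (next_prime_ex (kth_prime k')) else 0%N.

(* [None] stands for infinity. *)
Definition le_mu (i : nat) (mu : option nat) : bool :=
  if mu is Some m then (i <= m)%N else true.

(* As [P] is indexed from 0, its m-th term p_m is [P m.-1]. *)
Definition properly_arranged (P : nonzero_seq) : Prop :=
  forall k : nat, (0 < k)%N ->
    exists mu : option nat, forall i : nat, (0 < i)%N ->
      P (f0 k i).-1 = if le_mu i mu then (kth_prime k)%:Z else 1.

Definition homeomorphism (X Y : topologicalType) (h : X -> Y) : Prop :=
  exists h' : Y -> X,
    [/\ cancel h h', cancel h' h, continuous h & continuous h'].

Definition increasing_hom (R : realType) (alpha : R -> R) : Prop :=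
  [/\ {morph alpha : s t / s + t}, continuous alpha &
      {homo alpha : s t / s < t}].

Definition flow_equivalence (R : realType) (X Y : topologicalType)
    (phi : R -> X -> X) (psi : R -> Y -> Y) (alpha : R -> R) (h : X -> Y) :
    Prop :=
  [/\ increasing_hom alpha, homeomorphism h &
      forall t x, h (phi t x) = psi (alpha t) (h x)].

Definition flows_equivalent (R : realType) (X Y : topologicalType)
    (phi : R -> X -> X) (psi : R -> Y -> Y) : Prop :=
  exists (alpha : R -> R) (h : X -> Y), flow_equivalence phi psi alpha h.

Definition linear_flow (R : realType) n (M : nonsingular_seq n)
    (w : 'cV[R]_n) (t : R) (x : solenoid R M) : solenoid R M :=
  sol_pi M (t *: w) + x.
Arguments linear_flow {R n} M w t x.

Definition irrational_vec (R : realType) (w : 'cV[R]_2) : Prop :=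
  forall k1 k2 : int,
    k1%:~R * w 0 0 + k2%:~R * w 1 0 = 0 -> k1 = 0 /\ k2 = 0.

Definition rational_vec (R : realType) (w : 'cV[R]_2) : Prop :=
  ~ irrational_vec w.

Definition sol_automorphism (R : realType) n (M : nonsingular_seq n)
    (h : solenoid R M -> solenoid R M) : Prop :=
  {morph h : x y / x + y} /\ homeomorphism h.

Definition represents_automorphism (R : realType) n (M : nonsingular_seq n)
    (A : 'M[R]_n) (h : solenoid R M -> solenoid R M) : Prop :=
  sol_automorphism h /\ forall t : 'cV[R]_n, h (sol_pi M t) = sol_pi M (A *m t).

(* Main.v *)
Require Import Defs.
From mathcomp Require Import all_boot all_order all_algebra.
From mathcomp Require Import all_classical all_reals all_analysis.
From mathcomp Require Import ring lra zify.
Import Order.TTheory GRing.Theory Num.Theory.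
Import numFieldNormedType.Exports.
Local Open Scope classical_set_scope.
Local Open Scope ring_scope.

Set Implicit Arguments.
Unset Strict Implicit.
Unset Printing Implicit Defensive.

(** Let [h] be an equivalence from the flow of [w] to the flow of [w'], and
    suppose first that [w] is irrational. Then [k x = h x - h 0] is still an
    equivalence, since translations commute with linear flows, and it satisfies
    [k (y + x) = k y + k x] for every [y] on the orbit of [0]: this is just the
    conjugacy equation. The orbit of [0] is dense because [w] is irrational
    ([irrational_orbit_dense]), both sides are continuous in [y] and the
    solenoid is Hausdorff, so [k] is a homomorphism, hence an automorphism
    ([irrational_flow_equivalence_automorphism]). If instead [w'] is
    irrational, the same applies to the inverse equivalence, whose existence
    rests on the fact that an increasing homomorphism of the line is multiplication by a positive
    number ([increasing_hom_linear]).

    If both vectors are rational, each is a positive multiple of the first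
    column of a unimodular integer matrix ([rational_vec_unimodular]). A
    quotient of two such matrices maps one direction to the other, and it acts
    on the solenoid level by level, because the bonding matrices are scalar and
    so commute with it ([rational_flows_automorphism]).

    It remains to read off the matrix of an automorphism. A continuous
    homomorphism from the line to the circle is linear modulo [1]
    ([circle_hom_linear]); applied to all coordinates of all levels this shows
    that a continuous homomorphism between solenoids is covered by a real
    matrix ([sol_hom_lift]), and the matrices of an automorphism and of its
    inverse are inverse to each other. The entry [(i, j)] is a proper multiplier
    because its multiplier map is the restriction of the automorphism between
    the inclusion of the [j]-th and the projection to the [i]-th one-dimensional
    factor ([sol_hom_multiplier]).

    All continuity arguments go through one description of neighbourhoods
    ([nbhs_solP]): since each level determines the lower ones, [y] is near [x]
    as soon as a single coordinate vector of [y - x] is small. *)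

(** * The circle *)

Section Circle.
Context {R : realType}.
Implicit Types (c d : circle R) (x y e : R).

Lemma circle_proj_surj c : exists x, circle_proj x = c.
Proof. by exists (repr c); rewrite /circle_proj reprK. Qed.

Lemma circle_proj0P x : circle_proj x = 0 <-> exists k : int, x = k%:~R.
Proof.
by rewrite -(raddf0 (@circle_proj R)) circle_projP; split=> -[k];
  rewrite subr0; exists k.
Qed.

Lemma circle_proj_int (k : int) : circle_proj k%:~R = 0 :> circle R.
Proof. by apply/circle_proj0P; exists k. Qed.

(** The open ball of radius [e] around [0] for the quotient distance. *)
Definition circle_small e c := exists2 u, `|u| < e & circle_proj u = c.

Lemma circle_small0 e : 0 < e -> circle_small e 0.
Proof. by exists 0; rewrite ?normr0 ?raddf0. Qed.

Lemma circle_smallW e e' c : e <= e' -> circle_small e c -> circle_small e' c.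
Proof. by move=> le [u ue uc]; exists u => //; exact: lt_le_trans le. Qed.

Lemma circle_smallD e e' c d : circle_small e c -> circle_small e' d ->
  circle_small (e + e') (c + d).
Proof.
move=> [u ue <-] [v ve <-]; exists (u + v); last by rewrite raddfD.
by rewrite (le_lt_trans (ler_normD _ _)) ?ltrD.
Qed.

Lemma circle_smallN e c : circle_small e c -> circle_small e (- c).
Proof. by move=> [u ue <-]; exists (- u); rewrite ?normrN ?raddfN. Qed.

Lemma circle_smallMz e c (k : int) : k != 0 -> circle_small e c ->
  circle_small (`|k%:~R| * e) (c *~ k).
Proof.
move=> k0 [u ue <-]; exists (k%:~R * u); last by rewrite mulrzl raddfMz.
by rewrite normrM ltr_pM2l ?normr_gt0 ?intr_eq0.
Qed.

Lemma circle_small_inj u v : `|u| < 2^-1 -> `|v| < 2^-1 ->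
  circle_proj u = circle_proj v :> circle R -> u = v.
Proof.
move=> uh vh /circle_projP[k uvk]; apply/eqP; rewrite -subr_eq0 uvk intr_eq0.
have : `|k%:~R : R| < 1.
  rewrite -uvk (le_lt_trans (ler_normB _ _)) //.
  by rewrite [ltRHS](splitr 1) -div1r ltrD ?div1r.
rewrite -intr_norm -[1]/(1%:~R) ltr_int => k1.
by rewrite -normr_le0 -ltzD1.
Qed.

(** The circle is Hausdorff: a nonzero representative [u] of [c] with
    [`|u| < 1/2] is the shortest one, so [c] is not within [`|u|] of [0]. *)
Lemma circle_small_eq0 c : (forall e, 0 < e -> circle_small e c) -> c = 0.
Proof.
move=> sc; have [|u uh uc] := sc 2^-1; first by lra.
have [u0|u_neq0] := eqVneq u 0; first by rewrite -uc u0 raddf0.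
have [|v vu vc] := sc `|u|; first by rewrite normr_gt0.
have uv : u = v by apply: circle_small_inj uh (lt_trans vu uh) _; rewrite uc.
by move: vu; rewrite uv ltxx.
Qed.

(** The projection is open, so the balls around [0], translated, form a
    neighbourhood basis. *)
Lemma nbhs_circleP c (U : set (circle R)) : nbhs c U <->
  exists2 e, 0 < e & forall d, circle_small e (d - c) -> U d.
Proof.
split=> [|[e e0 eU]].
  have [x <-] := circle_proj_surj c => xU.
  have := @pi_continuous _ (quotient_topology (Quotient.quot (@integers R))) x.
  move=> /(_ _ xU) /nbhs_ballP[e /= e0 eU]; exists e => // d [u ue ud].
  have -> : d = circle_proj (x + u) by rewrite raddfD /= ud addrC subrK.
  by apply: eU; rewrite /ball /= opprD addNKr normrN.
apply: (@filterS _ _ _ [set d | circle_small e (d - c)]) => //.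
apply: open_nbhs_nbhs; split; last by rewrite /= subrr; exact: circle_small0.
(* The preimage of a ball of the circle is open in the line. *)
rewrite /open /= /quotient_open openE => y [u ue uy]; apply/nbhs_ballP.
exists (e - `|u|); rewrite /= ?subr_gt0 // => z; rewrite /ball /= => yz.
exists (u + (z - y)).
  by rewrite (le_lt_trans (ler_normD _ _)) // -ltrBrDl distrC.
by rewrite raddfD raddfB /= uy addrC addrA subrK.
Qed.

(** A continuous homomorphism is linear near [0]: if [f h] is represented by a
    small [c], then [f (h / 2)] is represented by [c / 2] or
    [c / 2 + 1 / 2], and smallness excludes the second. So [f] agrees with
    multiplication by [c / h] on the dyadic multiples of [h]; these are dense,
    and a homomorphism is uniformly continuous. *)
Lemma circle_hom_linear (f : R -> circle R) :
  {morph f : s t / s + t} ->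
  (forall e, 0 < e -> exists2 d : R, 0 < d &
    forall t, `|t| < d -> circle_small e (f t)) ->
  exists a, forall t, f t = circle_proj (a * t).
Proof.
move=> fD fcont.
have f0 : f 0 = 0 by apply: (addrI (f 0)); rewrite -fD !addr0.
have fN t : f (- t) = - f t by apply: (addrI (f t)); rewrite -fD !subrr f0.
have fMn n t : f (n%:R * t) = f t *+ n.
  elim: n => [|n IH]; first by rewrite mul0r f0.
  by rewrite -natr1 mulrDl mul1r fD IH mulrSr.
have fMz (k : int) t : f (k%:~R * t) = f t *~ k.
  by case: k => n; rewrite ?NegzE ?mulrNz ?mulNr ?fN -pmulrn fMn.
(* With representatives below 1/4 in absolute value, the sum of two of them is
   below 1/2, where representatives are unique. *)
have [|d d0 fd] := fcont 4^-1; first by lra.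
have h0 : 0 < d / 2 by rewrite divr_gt0.
pose h := d / 2.
have fh n : circle_small 4^-1 (f (h / 2 ^+ n)).
  apply: fd; rewrite gtr0_norm ?divr_gt0 ?exprn_gt0 //.
  rewrite ltr_pdivrMr ?exprn_gt0 // /h.
  apply: lt_le_trans (_ : d <= _); first by lra.
  by rewrite ler_peMr ?exprn_ege1 ?ltW //; lra.
have [c c4 ch] := fh 0%N.
have cn n : f (h / 2 ^+ n) = circle_proj (c / 2 ^+ n) /\ `|c / 2 ^+ n| < 4^-1.
  elim: n => [|n [IH IHlt]]; first by rewrite expr0 !divr1 in ch *; split.
  have [v v4 vh] := fh n.+1.
  have half x : x / 2 ^+ n.+1 + x / 2 ^+ n.+1 = x / 2 ^+ n.
    rewrite exprS; field; exact: expf_neq0.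
  have vv : v + v = c / 2 ^+ n.
    apply: circle_small_inj.
    - by rewrite (le_lt_trans (ler_normD _ _)) //; lra.
    - by lra.
    - by rewrite raddfD /= vh -fD half IH.
  have vE : v = c / 2 ^+ n.+1 by have := half c; lra.
  by rewrite -vE.
exists (c / h) => t; apply/eqP; rewrite -subr_eq0; apply/eqP.
apply: circle_small_eq0 => e e0.
have [|d1 d10 fd1] := fcont (e / 2); first by lra.
(* The summand 1 keeps the bound on the slope positive when [c = 0]. *)
pose L := `|c| + 1.
have L0 : 0 < L by rewrite /L ltr_wpDl.
pose m := Num.min d1 (e / 2 * (h / L)).
have m0 : 0 < m.
  by rewrite /m lt_min d10 /= mulr_gt0 ?divr_gt0.
(* A dyadic step below [m] leaves a remainder on which both [f] and the linear
   map are within [e / 2] of [0]. *)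
have [n hn] : exists n, h / 2 ^+ n < m.
  have [n nlt] : exists n : nat, h / m < n%:R.
    exists (Num.bound (h / m)); apply: le_lt_trans (archi_boundP _) => //.
    by rewrite divr_ge0 ?ltW.
  exists n; rewrite ltr_pdivrMr ?exprn_gt0 // mulrC -ltr_pdivrMr //.
  apply: lt_trans nlt _; rewrite -natrX ltr_nat; exact: ltn_expl.
pose s := h / 2 ^+ n.
have s0 : 0 < s by rewrite divr_gt0 ?exprn_gt0.
pose k := Num.floor (t / s); pose r := t - k%:~R * s.
have rm : `|r| < m.
  apply: lt_trans hn; rewrite ger0_norm /r.
    rewrite ltrBlDl -[X in _ + X]mul1r -mulrDl -ltr_pdivrMr //.
    by rewrite -intrD1 floorD1_gt.
  by rewrite subr_ge0 -ler_pdivlMr // floor_le.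
have -> : f t - circle_proj (c / h * t) = f r - circle_proj (c / h * r).
  have -> : t = k%:~R * s + r by rewrite /r addrC subrK.
  rewrite fD fMz (cn n).1 mulrDr raddfD /=.
  have -> : c / h * (k%:~R * s) = k%:~R * (c / 2 ^+ n).
    by rewrite mulrCA; congr (_ * _); rewrite /s mulrA divfK ?gt_eqF.
  by rewrite mulrzl raddfMz /= opprD addrACA subrr add0r.
rewrite [e]splitr; apply: circle_smallD.
  by apply: fd1; apply: lt_le_trans rm _; rewrite ge_min lexx.
apply: circle_smallN; exists (c / h * r) => //.
have rlt : `|r| < e / 2 * (h / L).
  by apply: lt_le_trans rm _; rewrite ge_min lexx orbT.
rewrite normrM normf_div (gtr0_norm h0).
apply: le_lt_trans (_ : `|c| / h * (e / 2 * (h / L)) < _).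
  by apply: ler_wpM2l (ltW rlt); rewrite divr_ge0 // ltW.
have -> : `|c| / h * (e / 2 * (h / L)) = e / 2 * (`|c| / L).
  rewrite mulrCA; congr (_ * _).
  by rewrite mulrA divfK ?gt_eqF.
by rewrite gtr_pMr ?divr_gt0 // ltr_pdivrMr // mul1r /L ltrDl.
Qed.

End Circle.

(** * The topology of solenoids *)

Lemma continuous_eq_dense (X Y : topologicalType) (D : set X) (f g : X -> Y) :
  hausdorff_space Y -> dense D -> continuous f -> continuous g ->
  {in D, f =1 g} -> f =1 g.
Proof.
move=> hY dD fc gc fg x; apply: hY => A B fA gB.
have : nbhs x (f @^-1` A `&` g @^-1` B).
  by apply: filterI; [exact: fc|exact: gc].
rewrite nbhsE => -[V [oV Vx] VAB].
have [|d [Od Dd]] := dD V _ oV; first by exists x.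
have [Afd Bgd] := VAB _ Od; exists (f d); split=> //.
  by rewrite fg ?inE.
Qed.

Section Solenoid.
Context {R : realType} {n : nat}.

Section Coordinates.
Context {M : nonsingular_seq n}.
Implicit Types (x y z : solenoid R M).

Definition sol_coord x N i : circle R := sol_val x N i 0.

Lemma sol_coordB x y N i :
  sol_coord (x - y) N i = sol_coord x N i - sol_coord y N i.
Proof.
rewrite /sol_coord [sol_val _](raddfB (val : solenoid R M -> torus_seq R n)).
by rewrite torus_seqB !mxE.
Qed.

Lemma sol_coord0 N i : sol_coord 0 N i = 0.
Proof. by rewrite -(subrr 0) sol_coordB subrr. Qed.

Lemma sol_coordN x N i : sol_coord (- x) N i = - sol_coord x N i.
Proof. by rewrite -sub0r sol_coordB sol_coord0 sub0r. Qed.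

Lemma sol_coordD x y N i :
  sol_coord (x + y) N i = sol_coord x N i + sol_coord y N i.
Proof. by rewrite -[y]opprK sol_coordB sol_coordN !opprK. Qed.

Lemma sol_coord_inj x y :
  (forall N i, sol_coord x N i = sol_coord y N i) -> x = y.
Proof.
move=> xy; apply: val_inj; apply/funext => N; apply/matrixP => i j.
by rewrite ord1; exact: xy.
Qed.

Lemma sol_coord_continuous N i : continuous (fun x => sol_coord x N i).
Proof.
move=> x; apply: (@continuous_comp _ _ _ (fun x => sol_val x N)
    (fun v : torus R n => v i 0)).
  apply: (@continuous_comp _ _ _ (@sol_val R n M)
    (fun f : torus_seq R n => f N)).
    exact: (@initial_continuous _ _ (@sol_val R n M)).
  exact: (@proj_continuous nat (fun=> torus R n) N).
move=> /= U xU; exists (fun i' _ => [set c | i' = i -> U c]) => [i' j|v /= vU].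
  have [->|i'i] := eqVneq i' i.
    by rewrite ord1; apply: filterS xU => c Uc _.
  by apply: filterS filterT => c _ ii'; rewrite ii' eqxx in i'i.
exact: vU.
Qed.

End Coordinates.

Section Scalar.
Context {P : nonzero_seq}.
Local Notation S := (solenoid R (scalar_seq n P)).
Implicit Types (x y z : S).

Lemma sol_coordS x N i : sol_coord x N i = sol_coord x N.+1 i *~ P N.
Proof.
have /in_solenoidP/(_ N) xN := sol_valP x.
rewrite /sol_coord xN mxE (bigD1 i) //= mxE eqxx mulr1n big1 ?addr0 // => j ji.
by rewrite mxE eq_sym (negPf ji) mulr0n mulr0z.
Qed.

Lemma sol_pi_coord (t : 'cV[R]_n) N i :
  sol_coord (sol_pi (scalar_seq n P) t) N i =
  circle_proj (t i 0 / (\prod_(j < N) P j)%:~R).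
Proof.
rewrite /sol_coord /= mxE; congr circle_proj.
elim: N => [|N IH] /=; first by rewrite big_ord0 divr1.
rewrite map_scalar_mx invmx_scalar mul_scalar_mx mxE IH big_ord_recr /=.
by rewrite intrM invfM mulrC mulrA.
Qed.

(** Only level [N] is constrained: it determines the lower levels, so these sets
    already form a basis of neighbourhoods of [0]. *)
Definition sol_small N e x := forall i, circle_small e (sol_coord x N i).

Lemma sol_smallW N e e' x : e <= e' -> sol_small N e x -> sol_small N e' x.
Proof. by move=> ee' sx i; exact: circle_smallW (sx i). Qed.

Lemma sol_smallD N e e' x y :
  sol_small N e x -> sol_small N e' y -> sol_small N (e + e') (x + y).
Proof. by move=> sx sy i; rewrite sol_coordD; exact: circle_smallD. Qed.

Lemma sol_smallN N e x : sol_small N e x -> sol_small N e (- x).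
Proof. by move=> sx i; rewrite sol_coordN; exact: circle_smallN. Qed.

(** Passing from level [N'] down to [N] multiplies coordinates by the product
    of the intermediate terms, so radii only have to be divided by it. *)
Lemma sol_small_level N N' e : (N <= N')%N -> 0 < e ->
  exists2 e', 0 < e' & forall x, sol_small N' e' x -> sol_small N e x.
Proof.
move=> /subnKC <-; elim: (N' - N)%N => [|d IH] e0.
  by exists e => // x; rewrite addn0.
have [e' e'0 sm] := IH e0; have P0 := seq_int_neq0 P (N + d).
exists (e' / `|(P (N + d))%:~R|).
  by rewrite divr_gt0 // normr_gt0 intr_eq0.
move=> x sx; apply: sm => i; rewrite sol_coordS -addnS.
rewrite -[e'](divfK (x := `|(P (N + d))%:~R|)) ?normr_eq0 ?intr_eq0 //.
by rewrite mulrC; exact: circle_smallMz.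
Qed.

(** The translates of the sets [sol_small N e] generate a filter at [x], as any
    two of them contain a third one at a common level. It converges to [x]
    because all its coordinates do; conversely its sets are neighbourhoods
    because they constrain only finitely many coordinates. *)
Lemma nbhs_solP x (U : set S) : nbhs x U <->
  exists N e, 0 < e /\ forall y, sol_small N e (y - x) -> U y.
Proof.
pose B (p : nat * R) := [set y : S | sol_small p.1 p.2 (y - x)].
pose F := filter_from [set p : nat * R | 0 < p.2] B.
have FF : Filter F.
  apply: filter_from_filter => [|[N e] [N' e'] /= e0 e'0].
    by exists (0%N, 1) => /=.
  have [d d0 dN] := sol_small_level (leq_maxl N N') e0.
  have [d' d'0 dN'] := sol_small_level (leq_maxr N N') e'0.
  exists (maxn N N', Num.min d d') => /=; first by rewrite lt_min d0.
  move=> y /= sy; split; rewrite /B /=.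
    by apply: dN; apply: sol_smallW sy; rewrite ge_min lexx.
  by apply: dN'; apply: sol_smallW sy; rewrite ge_min lexx orbT.
have Fcoord N i (V : set (circle R)) : nbhs (sol_coord x N i) V ->
    F [set y | V (sol_coord y N i)].
  move=> /nbhs_circleP[e e0 eV]; exists (N, e) => // y /= sy.
  by apply: eV; rewrite -sol_coordB; exact: sy.
split=> [[_ [[V oV <-] Vx] VU]|[N [e [e0 eU]]]]; last first.
  suff : nbhs x [set y | forall i, circle_small e (sol_coord (y - x) N i)].
    exact: filterS.
  apply: (@filter_forall _ _ (fun i y => circle_small e (sol_coord (y - x) N i))
    (nbhs x)) => i.
  suff : nbhs x [set y | circle_small e (sol_coord y N i - sol_coord x N i)].
    by apply: filterS => y; rewrite /= sol_coordB.
  have := @sol_coord_continuous (scalar_seq n P) N i x.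
  move=> /(_ [set c | circle_small e (c - sol_coord x N i)]); apply.
  by apply/nbhs_circleP; exists e.
suff FU : F U by have [[N e] /= e0 eU] := FU; exists N, e; split.
apply: filterS VU _.
have : (@sol_val R n (scalar_seq n P)) @ F --> sol_val x.
  apply/cvg_sup => N A [_ [[W oW <-] Wx] WU].
  apply: filterS WU _ => /=.
  have : nbhs (sol_val x N) W by apply: open_nbhs_nbhs.
  move=> [Q Qx QW].
  have : F [set y | forall i, Q i 0 (sol_coord y N i)].
    apply: (@filter_forall _ _ (fun i y => Q i 0 (sol_coord y N i)) F FF) => i.
    exact: Fcoord (Qx i 0).
  by apply: filterS => y yQ; apply: QW => i j; rewrite ord1; exact: yQ.
by apply; exact: open_nbhs_nbhs.
Qed.

Lemma sol_hausdorff : hausdorff_space S.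
Proof.
move=> x y xy; apply: sol_coord_inj => N i; apply/eqP; rewrite -subr_eq0.
apply/eqP; apply: circle_small_eq0 => e e0.
have small_nbhs z : nbhs z [set y | sol_small N (e / 2) (y - z)].
  by apply/nbhs_solP; exists N, (e / 2); rewrite divr_gt0.
have [z [/= zx zy]] := xy _ _ (small_nbhs x) (small_nbhs y).
rewrite -sol_coordB [e]splitr -[x - y](_ : - (z - x) + (z - y) = _).
  by apply: sol_smallD zy i; exact: sol_smallN.
by rewrite opprB addrA subrK.
Qed.

End Scalar.
End Solenoid.

(** * Homomorphisms between solenoids *)

Section Maps.
Context {R : realType} {P : nonzero_seq}.
Local Notation S n := (solenoid R (scalar_seq n P)).

(** The form in which continuity is checked: a modulus for differences, which
    does not depend on the base point. *)
Lemma sol_uniform_continuous m n (f : S m -> S n) :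
  (forall N e, 0 < e -> exists N' e', 0 < e' /\
    forall x y, sol_small N' e' (y - x) -> sol_small N e (f y - f x)) ->
  continuous f.
Proof.
move=> fu x U fU; have [N [e [e0 eU]]] := (nbhs_solP _ _).1 fU.
have [N' [e' [e'0 fe]]] := fu N e e0.
suff : nbhs x (f @^-1` U) by [].
by apply/nbhs_solP; exists N', e'; split=> // y /fe; exact: eU.
Qed.

(** Continuity at [0], in the quantitative form that [circle_hom_linear]
    takes as hypothesis. *)
Lemma sol_hom_small m n (f : S m -> S n) N e : zmod_morphism f ->
  continuous f -> 0 < e ->
  exists N' e', 0 < e' /\ forall x, sol_small N' e' x -> sol_small N e (f x).
Proof.
move=> fB fc e0; have f0 : f 0 = 0 by rewrite -(subrr 0) fB subrr.
have /nbhs_solP[N' [e' [e'0 fe]]] : nbhs 0 [set x | sol_small N e (f x)].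
  have /(_ [set z | sol_small N e z]) := fc 0; apply.
  apply/nbhs_solP; exists N, e.
  by split=> // y; rewrite f0 subr0.
by exists N', e'; split=> // x xs; apply: fe; rewrite subr0.
Qed.

Lemma sol_translation_continuous n (a : S n) : continuous (fun x => x + a).
Proof.
apply: sol_uniform_continuous => N e e0; exists N, e; split=> // x y.
by rewrite opprD addrACA subrr addr0.
Qed.

Section IntegerMatrix.
Context {m n : nat} (L : 'M[int]_(n, m)).

Definition int_seq_map (x : torus_seq R m) : torus_seq R n :=
  fun N => \col_i \sum_j (x N j 0 *~ L i j).

(** The same integer matrix is used at every level; this is compatible with the
    bonding maps because those are scalar. *)
Fact int_seq_map_in (x : S m) :
  int_seq_map (sol_val x) \in in_solenoid R (scalar_seq n P).
Proof.
apply/in_solenoidP => N; apply/colP => i; rewrite !mxE.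
rewrite [RHS](bigD1 i) //= [X in _ + X]big1 => [|j ji].
  rewrite !mxE eqxx mulr1n addr0 mulrz_suml; apply: eq_bigr => j _.
  by rewrite mulrzAC; congr (_ *~ _); exact: sol_coordS.
by rewrite [in X in _ *~ X]mxE eq_sym (negPf ji) mulr0n mulr0z.
Qed.

Definition sol_map (x : S m) : S n := Solenoid (int_seq_map_in x).

Lemma sol_map_coord x N i :
  sol_coord (sol_map x) N i = \sum_j sol_coord x N j *~ L i j.
Proof. by rewrite /sol_coord /= mxE. Qed.

Lemma sol_map_zmod_morphism : zmod_morphism sol_map.
Proof.
move=> x y; apply: sol_coord_inj => N i; rewrite sol_coordB !sol_map_coord.
by rewrite -sumrB; apply: eq_bigr => j _; rewrite sol_coordB mulrzBl.
Qed.

Lemma sol_map_pi t :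
  sol_map (sol_pi (scalar_seq m P) t) = sol_pi _ (map_mx intr L *m t).
Proof.
apply: sol_coord_inj => N i; rewrite sol_map_coord !sol_pi_coord mxE.
rewrite mulr_suml raddf_sum; apply: eq_bigr => j _.
by rewrite sol_pi_coord mxE -mulrA mulrzl raddfMz.
Qed.

(** The sum of the absolute values of all entries bounds every row sum, hence
    serves as a Lipschitz constant; [1] is added to keep it nonzero. *)
Lemma sol_map_continuous : continuous sol_map.
Proof.
apply: sol_uniform_continuous => N e e0.
pose K : R := \sum_i \sum_j `|(L i j)%:~R| + 1.
have sum_ge0 i : 0 <= \sum_j `|(L i j)%:~R : R| by exact: sumr_ge0.
have K0 : 0 < K by rewrite ltr_wpDl // sumr_ge0.
exists N, (e / K); split; first exact: divr_gt0.
move=> x y; rewrite -sol_map_zmod_morphism; move: (y - x) => z zs i.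
rewrite sol_map_coord.
have small_sum (s : seq 'I_m) : circle_small
    (e / K * (\sum_(j <- s) `|(L i j)%:~R|) + e / K)
    (\sum_(j <- s) sol_coord z N j *~ L i j).
  elim: s => [|j s IH].
    by rewrite !big_nil mulr0 add0r; apply: circle_small0; exact: divr_gt0.
  rewrite !big_cons mulrDr -addrA.
  have [->|Lij] := eqVneq (L i j) 0.
    by rewrite normr0 mulr0 mulr0z !add0r.
  by apply: circle_smallD IH; rewrite mulrC; exact: circle_smallMz.
apply: circle_smallW (small_sum _).
rewrite -[X in _ + X]mulr1 -mulrDr -[leRHS](divfK (x := K)) ?gt_eqF //.
apply: ler_wpM2l; first by rewrite ltW // divr_gt0.
rewrite /K lerD2r.
by rewrite (bigD1 i) //= lerDl sumr_ge0.
Qed.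

End IntegerMatrix.
End Maps.

(** * Matrices of continuous homomorphisms *)

Lemma morphD_zmod_morphism (U V : zmodType) (f : U -> V) :
  {morph f : x y / x + y} -> zmod_morphism f.
Proof. by move=> fD x y; apply/eqP; rewrite eq_sym subr_eq -fD subrK. Qed.

Lemma zmod_morphism_morphD (U V : zmodType) (f : U -> V) :
  zmod_morphism f -> {morph f : x y / x + y}.
Proof.
move=> fB x y; have f0 : f 0 = 0 by rewrite -(subrr 0) fB subrr.
have fN z : f (- z) = - f z by rewrite -sub0r fB f0 sub0r.
by rewrite -{1}[y]opprK fB fN opprK.
Qed.

Lemma zmod_morphism_can (U V : zmodType) (f : U -> V) (g : V -> U) :
  cancel f g -> cancel g f -> zmod_morphism f -> zmod_morphism g.
Proof. by move=> fg gf fB x y; apply: (can_inj fg); rewrite fB !gf. Qed.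

(** Otherwise [(a - b) * t] would be an integer for every [t], in particular for
    the [t] that makes it [1 / 2]. *)
Lemma circle_proj_linear_inj (R : realType) (a b : R) :
  (forall t, circle_proj (a * t) = circle_proj (b * t) :> circle R) -> a = b.
Proof.
move=> ab; apply/eqP; rewrite -subr_eq0; apply/negPn/negP => c0.
have [k] := (circle_projP _ _).1 (ab ((a - b)^-1 / 2)).
rewrite -mulrBl mulrA divff // mul1r => k2.
have : (2 * k)%:~R = 1%:~R :> R by rewrite intrM -k2 mulfV.
by move/eqP; rewrite eqr_int => /eqP; lia.
Qed.

Section Lift.
Context {R : realType} {P : nonzero_seq}.
Local Notation S n := (solenoid R (scalar_seq n P)).
Local Notation rho N := ((\prod_(j < N) P j)%:~R : R).

Lemma prod_neq0 N : rho N != 0.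
Proof. by rewrite intr_eq0; apply/prodf_neq0 => j _; exact: seq_int_neq0. Qed.

Lemma sol_coord_level0 n (x : S n) N i :
  sol_coord x 0 i = sol_coord x N i *~ \prod_(j < N) P j.
Proof.
elim: N => [|N ->]; first by rewrite big_ord0.
by rewrite sol_coordS mulrzA_C big_ord_recr.
Qed.

Lemma sol_pi_small n N (e : R) : 0 < e -> exists2 d, 0 < d &
  forall v : 'cV[R]_n, (forall i, `|v i 0| < d) ->
    sol_small N e (sol_pi (scalar_seq n P) v).
Proof.
move=> e0; exists (e * `|rho N|).
  by rewrite mulr_gt0 // normr_gt0 prod_neq0.
move=> v vd i; rewrite sol_pi_coord; exists (v i 0 / rho N) => //.
by rewrite normf_div ltr_pdivrMr ?normr_gt0 ?prod_neq0.
Qed.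

Lemma sol_pi_mx_inj m n (A B : 'M[R]_(n, m)) :
  (forall t, sol_pi (scalar_seq n P) (A *m t) = sol_pi _ (B *m t)) -> A = B.
Proof.
move=> AB; apply/matrixP => i j; apply: circle_proj_linear_inj => t.
have := congr1 (fun x => sol_coord x 0 i) (AB (t *: delta_mx j 0)).
rewrite !sol_pi_coord big_ord0 !divr1 -!scalemxAr -!colE !mxE.
by rewrite ![t * _]mulrC.
Qed.

(** On each axis, every coordinate of [f] is a continuous homomorphism from the
    line to the circle and so has a slope. The slopes at level [N] are those at
    level [0] divided by the first [N] terms, because multiplying level [N] by
    these terms gives level [0] and slopes are unique; this is exactly how
    [sol_pi] divides its argument. *)
Lemma sol_hom_lift m n (f : S m -> S n) : zmod_morphism f -> continuous f ->
  exists A : 'M[R]_(n, m), forall t,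
    f (sol_pi (scalar_seq m P) t) = sol_pi (scalar_seq n P) (A *m t).
Proof.
move=> fB fc; have fD := zmod_morphism_morphD fB.
have slope N i j : exists a, forall t,
    sol_coord (f (sol_pi (scalar_seq m P) (t *: delta_mx j 0))) N i
    = circle_proj (a * t).
  apply: circle_hom_linear => [s t|e e0].
    by rewrite scalerDl raddfD fD sol_coordD.
  have [N' [e' [e'0 fe]]] := sol_hom_small N fB fc e0.
  have [d d0 dsmall] := @sol_pi_small m N' e' e'0.
  exists d => // t td; apply: fe; apply: dsmall => k.
  rewrite !mxE eqxx andbT; case: eqP => _; first by rewrite mulr1.
  by rewrite mulr0 normr0.
have [a aE] : exists a : nat -> 'I_n -> 'I_m -> R, forall N i j t,
    sol_coord (f (sol_pi (scalar_seq m P) (t *: delta_mx j 0))) N i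
    = circle_proj (a N i j * t).
  exists (fun N i j => projT1 (cid (slope N i j))) => N i j.
  exact: projT2 (cid (slope N i j)).
have aN N i j : a N i j = a 0%N i j / rho N.
  apply: (canRL (mulfK (prod_neq0 N))); apply: circle_proj_linear_inj => t.
  rewrite -aE (sol_coord_level0 _ N) aE -raddfMz.
  by rewrite /= -[(_ * t) *~ _]mulrzl mulrCA mulrA.
exists (\matrix_(i, j) a 0%N i j) => t; apply: sol_coord_inj => N i.
have -> : t = \sum_j t j 0 *: delta_mx j 0.
  by rewrite [LHS]matrix_sum_delta; apply: eq_bigr => j _; rewrite big_ord1.
have f0 : f 0 = 0 by rewrite -(subrr 0) fB subrr.
rewrite raddf_sum (big_morph f fD f0).
rewrite (big_morph _ (fun x y => sol_coordD x y N i) (sol_coord0 N i)).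
rewrite sol_pi_coord mulmx_sumr summxE mulr_suml raddf_sum.
apply: eq_bigr => j _; rewrite aE aN -scalemxAr -colE !mxE.
by rewrite mulrC mulrA.
Qed.

Lemma C_continuous (f : S 1 -> S 1) (g : C_ R P -> C_ R P) :
  continuous f -> (forall x, C_val (g x) = f (C_val x)) -> continuous g.
Proof.
move=> /continuousP fc gf; apply/continuousP => _ [A oA <-].
exists (f @^-1` A); first exact: fc.
by apply/funext => x; rewrite /preimage /= gf.
Qed.

(** The multiplier map is [f] preceded by the inclusion of the [j]-th axis and
    followed by the projection to the [i]-th one. As a composite of continuous
    homomorphisms of whole solenoids it is continuous for the subspace topology,
    and it multiplies every parameter by [A i j], not only those in the domain
    on which the parametrization is bijective. *)
Lemma sol_hom_multiplier m n (f : S m -> S n) (A : 'M[R]_(n, m)) i j :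
  zmod_morphism f -> continuous f ->
  (forall t,
    f (sol_pi (scalar_seq m P) t) = sol_pi (scalar_seq n P) (A *m t)) ->
  proper_multiplier P P (A i j).
Proof.
move=> fB fc fA.
pose F (x : S 1) : S 1 := sol_map (delta_mx 0 i) (f (sol_map (delta_mx j 0) x)).
have FB : zmod_morphism F.
  by move=> x y; rewrite /F sol_map_zmod_morphism fB sol_map_zmod_morphism.
have Fc : continuous F.
  move=> x; apply: (@continuous_comp _ _ _ (sol_map (delta_mx j 0))
    (fun y => sol_map (delta_mx 0 i) (f y))); first exact: sol_map_continuous.
  apply: (@continuous_comp _ _ _ f (sol_map (delta_mx 0 i))); first exact: fc.
  exact: sol_map_continuous.
have Fpi s : F (pi1 P s) = pi1 P (A i j * s).
  rewrite /F /pi1 sol_map_pi fA sol_map_pi; congr sol_pi.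
  rewrite !map_delta_mx mul_mx_scalar -!scalemxAr -colE -rowE.
  by apply/matrixP => k l; rewrite !ord1 !mxE eqxx mulr1n mulrC.
have FC (x : C_ R P) : F (C_val x) \in in_C R P.
  by have /in_CP[s <-] := C_valP x; rewrite Fpi pi1_in.
exists (fun x => InC (FC x)); split=> [s _|x y|].
- by apply: val_inj; exact: Fpi.
- apply: val_inj; rewrite [RHS](raddfD val) /=.
  by rewrite -(zmod_morphism_morphD FB) -(raddfD val).
- exact: C_continuous Fc _.
Qed.

(** The inverse automorphism has a matrix too, and uniqueness of matrices
    makes the two inverse to each other. *)
Lemma sol_automorphism_matrix n (h : S n -> S n) : sol_automorphism h ->
  exists A : 'M[R]_n, [/\ A \in unitmx,
    forall i j, proper_multiplier P P (A i j) /\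
                proper_multiplier P P (invmx A i j) &
    represents_automorphism A h].
Proof.
move=> hauto; have [hD [g [hg gh hc gc]]] := hauto.
have hB := morphD_zmod_morphism hD.
have gB := zmod_morphism_can hg gh hB.
have [A hA] := sol_hom_lift hB hc; have [B gM] := sol_hom_lift gB gc.
have AB : A *m B = 1%:M.
  by apply: sol_pi_mx_inj => t; rewrite mul1mx -mulmxA -hA -gM gh.
have Au := (mulmx1_unit AB).1.
have AV : invmx A = B by rewrite -[LHS]mulmx1 -AB mulKmx.
exists A; split=> // i j; rewrite AV; split.
  exact: (sol_hom_multiplier _ _ hB hc hA).
exact: (sol_hom_multiplier _ _ gB gc gM).
Qed.

End Lift.

(** * Dense orbits *)

Section IrrationalRotation.
Context {R : realType} (a : R)
  (a_irr : forall k l : int, k%:~R * a + l%:~R = 0 -> k = 0).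

Let G (x : R) := exists k l : int, x = k%:~R * a + l%:~R.

Let GB x y : G x -> G y -> G (x - y).
Proof.
move=> [k [l ->]] [k' [l' ->]]; exists (k - k'), (l - l').
by rewrite !intrD !mulrNz; ring.
Qed.

Let GM (m : int) x : G x -> G (m%:~R * x).
Proof.
by move=> [k [l ->]]; exists (m * k), (m * l); rewrite !intrM; ring.
Qed.

(** Reduce [a] and [1] modulo [g]: they cannot both be multiples of [g], as [a]
    would then be rational. A nonzero remainder [r] lies strictly between [0]
    and [g], and [r] or [g - r] is at most [g / 2]. *)
Let G_halve g : G g -> 0 < g -> exists g', [/\ G g', 0 < g' & g' <= g / 2].
Proof.
move=> Gg g0.
pose r x := x - (Num.floor (x / g))%:~R * g.
have Gr x : G x -> G (r x) by move=> Gx; apply: GB => //; exact: GM.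
have r_ge0 x : 0 <= r x by rewrite subr_ge0 -ler_pdivlMr // floor_le.
have r_lt x : r x < g.
  rewrite ltrBlDl -[X in _ + X]mul1r -mulrDl -ltr_pdivrMr //.
  by rewrite -intrD1 floorD1_gt.
have [x Gx rx0] : exists2 x, G x & r x != 0.
  have [ra0|ra] := eqVneq (r a) 0; last first.
    by exists a => //; exists 1, 0; rewrite mul1r addr0.
  exists 1; first by exists 0, 1; rewrite mul0r add0r.
  apply/eqP => /eqP; rewrite subr_eq0 => /eqP r10.
  move: ra0 => /eqP; rewrite subr_eq0 => /eqP ra0.
  move: r10 ra0; set q := Num.floor _; set m := Num.floor _ => r10 ra0.
  have q0 : q = 0.
    apply: (a_irr (l := - m)); rewrite ra0 mulrCA -r10 mulr1 mulrNz.
    by rewrite subrr.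
  by move/eqP: r10; rewrite q0 mul0r oner_eq0.
have rx_gt0 : 0 < r x by rewrite lt_neqAle eq_sym rx0 r_ge0.
have [le|gt] := lerP (r x) (g / 2).
  by exists (r x); split; first exact: Gr.
exists (g - r x); split; first by apply: GB => //; exact: Gr.
  by rewrite subr_gt0.
by have := r_lt x; lra.
Qed.

(** The group generated by [a] and [1] has arbitrarily small positive elements
    by repeated halving, and the multiples of a small one come close to
    everything. *)
Lemma irrational_rotation_dense (z e : R) : 0 < e ->
  exists k l : int, `|k%:~R * a + l%:~R - z| < e.
Proof.
move=> e0.
have [n ne] : exists n, (2^-1 : R) ^+ n < e.
  exists (Num.bound e^-1); rewrite exprVn invf_plt ?posrE ?exprn_gt0 //.
  apply: lt_trans (archi_boundP _) _; first by rewrite invr_ge0 ltW.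
  by rewrite -natrX ltr_nat ltn_expl.
have [g [Gg g0 ge]] : exists g, [/\ G g, 0 < g & g <= 2^-1 ^+ n].
  elim: n {ne} => [|n [g [Gg g0 ge]]].
    by exists 1; split=> //; exists 0, 1; rewrite mul0r add0r.
  have [g' [Gg' g'0 g'e]] := G_halve Gg g0; exists g'; split=> //.
  by rewrite exprSr (le_trans g'e) // ler_pM2r ?invr_gt0.
have [k [l gE]] := GM (Num.floor (z / g)) Gg.
exists k, l; rewrite -gE distrC ger0_norm; last first.
  by rewrite subr_ge0 -ler_pdivlMr // floor_le.
apply: lt_trans (le_lt_trans ge ne).
rewrite ltrBlDl -[X in _ + X]mul1r -mulrDl -ltr_pdivrMr //.
by rewrite -intrD1 floorD1_gt.
Qed.

End IrrationalRotation.

(** * Linear flows *)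

Section Flows.
Context {R : realType} {P : nonzero_seq}.
Local Notation S n := (solenoid R (scalar_seq n P)).
Local Notation rho N := ((\prod_(j < N) P j)%:~R : R).

(** Times at which the first coordinate at level [N] is exactly that of [x] form
    an arithmetic progression, along which the second coordinate performs a
    rotation by the irrational number [w 1 0 / w 0 0]. *)
Lemma irrational_orbit_dense (w : 'cV[R]_2) : irrational_vec w ->
  dense (range (fun t => sol_pi (scalar_seq 2 P) (t *: w))).
Proof.
move=> wirr U [x Ux] oU.
have /nbhs_solP[N [e [e0 eU]]] : nbhs x U by exact: open_nbhs_nbhs.
have w0 : w 0 0 != 0.
  apply/eqP => w0; have [] := wirr 1 0; first by rewrite w0 mulr0 mul0r addr0.
  by [].
have airr k l : k%:~R * (w 1 0 / w 0 0) + l%:~R = 0 -> k = 0.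
  move=> kl; suff /wirr[] : l%:~R * w 0 0 + k%:~R * w 1 0 = 0 by [].
  rewrite addrC.
  by rewrite -[RHS](mul0r (w 0 0)) -kl mulrDl mulrA divfK.
have [y0 y0E] := circle_proj_surj (sol_coord x N 0).
have [y1 y1E] := circle_proj_surj (sol_coord x N 1).
have [k [l kl]] :=
  irrational_rotation_dense airr (y1 - y0 * (w 1 0 / w 0 0)) e0.
pose t := (y0 + k%:~R) * rho N / w 0 0.
exists (sol_pi _ (t *: w)); split; last by exists t.
apply: eU => i; rewrite sol_coordB sol_pi_coord mxE.
have rho0 := prod_neq0 (R := R) (P := P) N.
have [->|->] : i = 0 \/ i = 1.
  by case: i => [[|[|//]] ilt]; [left|right]; apply: val_inj.
- rewrite (_ : t * w 0 0 / rho N = y0 + k%:~R); last first.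
    by rewrite /t divfK // mulfK.
  rewrite raddfD /= y0E circle_proj_int addr0 subrr; exact: circle_small0.
rewrite -y1E -raddfB; exists (k%:~R * (w 1 0 / w 0 0) + l%:~R
  - (y1 - y0 * (w 1 0 / w 0 0))) => //.
apply/circle_projP; exists l; rewrite /t.
rewrite (_ : _ * rho N / w 0 0 * w 1 0 / rho N =
  (y0 + k%:~R) * (w 1 0 / w 0 0)); last first.
  rewrite [_ / w 0 0]mulrAC [_ * rho N * _]mulrAC mulfK //.
  by rewrite -mulrA [_^-1 * _]mulrC.
ring.
Qed.

Lemma homeomorphism_translate n (h : S n -> S n) (a : S n) :
  homeomorphism h -> homeomorphism (fun x => h x - a).
Proof.
move=> [g [hg gh hc gc]]; exists (fun x => g (x + a)); split.
- by move=> x; rewrite subrK hg.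
- by move=> x; rewrite gh addrK.
- move=> x; apply: (@continuous_comp _ _ _ h (fun y => y - a)); first exact: hc.
  exact: sol_translation_continuous.
- move=> x; apply: (@continuous_comp _ _ _ (fun y => y + a) g); last exact: gc.
  exact: sol_translation_continuous.
Qed.

(** For [y] on the orbit of [0], additivity [k (y + x) = k y + k x] is the
    conjugacy equation; it extends to all [y] by density. *)
Lemma irrational_flow_equivalence_automorphism (w w' : 'cV[R]_2) alpha
    (h : S 2 -> S 2) :
  irrational_vec w ->
  flow_equivalence (linear_flow (scalar_seq 2 P) w)
                   (linear_flow (scalar_seq 2 P) w') alpha h ->
  let k x := h x - h 0 in
  sol_automorphism k /\
  flow_equivalence (linear_flow (scalar_seq 2 P) w)
                   (linear_flow (scalar_seq 2 P) w') alpha k.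
Proof.
move=> wirr [ainc hh hflow] k.
have kh : homeomorphism k by exact: homeomorphism_translate.
have kflow t x : k (sol_pi _ (t *: w) + x) = sol_pi _ (alpha t *: w') + k x.
  by rewrite /k [h _]hflow addrA.
have k0 : k 0 = 0 by rewrite /k subrr.
have kc : continuous k by case: kh => ? [].
split; last by split.
split=> // x y.
have := @continuous_eq_dense _ _ _ (fun x => k (x + y)) (fun x => k x + k y)
  (@sol_hausdorff R 2 P) (irrational_orbit_dense wirr).
apply=> [z|z|z].
- apply: (@continuous_comp _ _ _ (fun x => x + y) k); last exact: kc.
  exact: sol_translation_continuous.
- apply: (@continuous_comp _ _ _ k (fun x => x + k y)); first exact: kc.
  exact: sol_translation_continuous.
- rewrite inE => -[t _ <-]; rewrite kflow -[sol_pi _ (t *: w)]addr0 kflow.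
  by rewrite k0 addr0.
Qed.

(** Reduced modulo [1], [alpha] is linear by [circle_hom_linear], so it differs
    from a linear map by an additive integer-valued function. Such a function
    vanishes, as its values are divisible by every positive integer. *)
Lemma increasing_hom_linear (alpha : R -> R) : increasing_hom alpha ->
  exists2 a, 0 < a & forall t, alpha t = a * t.
Proof.
move=> [aD ac ainc].
have aB := morphD_zmod_morphism aD.
have a0 : alpha 0 = 0 by have := aB 0 0; rewrite !subrr.
have [a aE] : exists a, forall t, circle_proj (alpha t) = circle_proj (a * t).
  apply: circle_hom_linear => [s t|e e0]; first by rewrite aD raddfD.
  have /nbhs_ballP[d /= d0 dV] : nbhs 0 [set t | `|alpha t| < e].
    have /(_ [set y | `|y| < e]) := ac 0; apply; rewrite a0.
    by apply/nbhs_ballP; exists e => //= y; rewrite /ball /= sub0r normrN.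
  exists d => // t td; exists (alpha t) => //.
  by apply: dV; rewrite /ball /= sub0r normrN.
have aMn n t : alpha (n%:R * t) = n%:R * alpha t.
  elim: n => [|n IH]; first by rewrite !mul0r.
  by rewrite -natr1 !mulrDl !mul1r aD IH.
have aL t : alpha t = a * t.
  have [k kE] := (circle_projP _ _).1 (aE t).
  have [l lE] := (circle_projP _ _).1 (aE (t / `|k|.+1%:R)).
  have n0 : (`|k|.+1%:R : R) != 0 by rewrite pnatr_eq0.
  have tE : `|k|.+1%:R * (t / `|k|.+1%:R) = t by rewrite mulrC divfK.
  have kl : k = `|k|.+1%:Z * l.
    apply: (@intr_inj R); rewrite intrM -kE -lE mulrBr.
    by rewrite -pmulrn -aMn tE mulrCA tE.
  (* A multiple of an integer larger than its own absolute value is zero. *)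
  have k0 : k = 0.
    apply/eqP; rewrite -absz_eq0.
    have := congr1 absz kl; rewrite abszM absz_nat.
    by move: `|k|%N `|l|%N => p [|m] pE; [rewrite pE muln0 | nia].
  by apply/eqP; rewrite -subr_eq0 kE k0.
exists a => //.
by rewrite -[a]mulr1 -aL -a0 ainc.
Qed.

Lemma scaling_increasing_hom (a : R) : 0 < a ->
  increasing_hom (fun t => a * t).
Proof.
move=> a0; split=> [s t|t|s t st]; first by rewrite mulrDr.
- exact: mulrl_continuous.
- by rewrite ltr_pM2l.
Qed.

Lemma flow_equivalence_sym (X Y : topologicalType) (phi : R -> X -> X)
    (psi : R -> Y -> Y) alpha h : flow_equivalence phi psi alpha h ->
  exists beta k, [/\ flow_equivalence psi phi beta k, cancel h k & cancel k h].
Proof.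
move=> [ainc [k [hk kh hc kc]] hflow].
have [a a0 aE] := increasing_hom_linear ainc.
exists (fun t => a^-1 * t), k; split=> //; split.
- by apply: scaling_increasing_hom; rewrite invr_gt0.
- by exists h.
- move=> t y; apply: (can_inj hk); rewrite kh hflow aE kh.
  by rewrite mulVKf // gt_eqF.
Qed.

Lemma sol_automorphism_inv n (h k : S n -> S n) :
  sol_automorphism h -> cancel h k -> cancel k h -> sol_automorphism k.
Proof.
move=> [hD [g [hg gh hc gc]]] hk kh.
have -> : k = g by apply/funext => x; apply: (can_inj hg); rewrite kh gh.
split; last by exists h.
by apply: zmod_morphism_morphD; apply: zmod_morphism_can hg gh _;
  exact: morphD_zmod_morphism.
Qed.

Lemma sol_map_cancel m n (L : 'M[int]_(n, m)) (K : 'M[int]_(m, n)) :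
  K *m L = 1%:M -> cancel (@sol_map R P _ _ L) (sol_map K).
Proof.
move=> KL x; apply: sol_coord_inj => N i; rewrite sol_map_coord.
under eq_bigr => j _ do rewrite sol_map_coord mulrz_suml.
rewrite exchange_big (bigD1 i) //= [X in _ + X]big1 => [|j ji].
  under eq_bigr => j _ do rewrite -mulrzA mulrC.
  rewrite -mulrz_sumr addr0.
  have := congr1 (fun M : 'M[int]_m => M i i) KL; rewrite !mxE eqxx => ->.
  by rewrite mulr1z.
under eq_bigr => l _ do rewrite -mulrzA mulrC.
rewrite -mulrz_sumr.
have := congr1 (fun M : 'M[int]_m => M i j) KL.
rewrite !mxE eq_sym (negPf ji) => ->.
by rewrite mulr0z.
Qed.

Lemma sol_map_automorphism n (L : 'M[int]_n) : L \in unitmx ->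
  sol_automorphism (@sol_map R P _ _ L).
Proof.
move=> Lu; split; first exact: (zmod_morphism_morphD (sol_map_zmod_morphism L)).
exists (sol_map (invmx L)); split; try exact: sol_map_continuous.
  by apply: sol_map_cancel; rewrite mulVmx.
by apply: sol_map_cancel; rewrite mulmxV.
Qed.

(** The integer relation satisfied by [w], divided by the gcd of its
    coefficients, is [q1 * w 0 0 + q2 * w 1 0 = 0] with [q1], [q2] coprime. So
    [w] is a multiple of [(- q2, q1)], and Bezout coefficients complete this
    column to a matrix of determinant [1]. *)
Lemma rational_vec_unimodular (w : 'cV[R]_2) : w != 0 -> rational_vec w ->
  exists (U : 'M[int]_2) (c : R), [/\ U \in unitmx, 0 < c &
    w = c *: (map_mx intr U *m delta_mx 0 0)].
Proof.
move=> w0 wrat.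
have [k1 [k2 [kw k0]]] : exists k1 k2 : int,
    k1%:~R * w 0 0 + k2%:~R * w 1 0 = 0 /\ ~ (k1 = 0 /\ k2 = 0).
  apply: contra_notP wrat => /forallNP nk k1 k2 kw; apply: contrapT => k0.
  by apply: (nk k1); exists k2.
have d0 : gcdz k1 k2 != 0.
  by rewrite gcdz_eq0; apply/negP => /andP[/eqP ? /eqP ?]; apply: k0.
pose q1 := (k1 %/ gcdz k1 k2)%Z; pose q2 := (k2 %/ gcdz k1 k2)%Z.
have k1E : k1 = q1 * gcdz k1 k2 by rewrite divzK ?dvdz_gcdl.
have k2E : k2 = q2 * gcdz k1 k2 by rewrite divzK ?dvdz_gcdr.
have [u [v uv]] := Bezoutz k1 k2.
have uvq : u * q1 + v * q2 = 1.
  by apply: (mulIf d0); rewrite mulrDl -!mulrA -k1E -k2E uv mul1r.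
have qw : q1%:~R * w 0 0 + q2%:~R * w 1 0 = 0.
  apply: (mulIf (x := (gcdz k1 k2)%:~R)); first by rewrite intr_eq0.
  rewrite mul0r -[RHS]kw {2}k1E {3}k2E !intrM; ring.
(* The multiple is the product of the row [(- v, u)] with [w]; changing all
   four signs makes it nonnegative. *)
have {q1 q2 u v k1E k2E uv uvq qw} [q1 [q2 [u [v [uvq qw c0]]]]] :
    exists q1 q2 u v : int, [/\ u * q1 + v * q2 = 1,
      q1%:~R * w 0 0 + q2%:~R * w 1 0 = 0 &
      0 <= u%:~R * w 1 0 - v%:~R * w 0 0].
  have [c0|c0] := lerP 0 (u%:~R * w 1 0 - v%:~R * w 0 0).
    by exists q1, q2, u, v.
  exists (- q1), (- q2), (- u), (- v); split; first by rewrite !mulrNN.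
    by rewrite !mulrNz !mulNr -opprD qw oppr0.
  by rewrite !mulrNz; lra.
have uvqR : u%:~R * q1%:~R + v%:~R * q2%:~R = 1 :> R.
  by rewrite -!intrM -intrD uvq.
set c := _ - _ in c0.
have w0E : w 0 0 = - (c * q2%:~R).
  apply/eqP; rewrite -subr_eq0; apply/eqP.
  transitivity (w 0 0 * (1 - (u%:~R * q1%:~R + v%:~R * q2%:~R))
    + u%:~R * (q1%:~R * w 0 0 + q2%:~R * w 1 0)); first by rewrite /c; ring.
  by rewrite uvqR qw subrr !mulr0 addr0.
have w1E : w 1 0 = c * q1%:~R.
  apply/eqP; rewrite -subr_eq0; apply/eqP.
  transitivity (w 1 0 * (1 - (u%:~R * q1%:~R + v%:~R * q2%:~R))
    + v%:~R * (q1%:~R * w 0 0 + q2%:~R * w 1 0)); first by rewrite /c; ring.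
  by rewrite uvqR qw subrr !mulr0 addr0.
have ord2 (i : 'I_2) : i = 0 \/ i = 1.
  by case: i => [[|[|//]] ilt]; [left|right]; apply: val_inj.
have c_gt0 : 0 < c.
  rewrite lt_neqAle c0 andbT eq_sym; apply: contra_neq w0 => cE.
  apply/matrixP => i j; rewrite ord1 mxE; have [->|->] := ord2 i.
    by rewrite w0E cE mul0r oppr0.
  by rewrite w1E cE mul0r.
pose U : 'M[int]_2 := \matrix_(i, j)
  (if i == 0 then (if j == 0 then - q2 else - u)
             else (if j == 0 then q1 else - v)).
pose V : 'M[int]_2 := \matrix_(i, j)
  (if i == 0 then (if j == 0 then - v else u)
             else (if j == 0 then - q1 else - q2)).
have VU : V *m U = 1%:M.
  apply/matrixP => i j; rewrite !mxE !big_ord_recl big_ord0 !mxE /=.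
  by have [->|->] := ord2 i; have [->|->] := ord2 j => /=; rewrite -?uvq; ring.
exists U, c; split=> //; first exact: (mulmx1_unit VU).2.
apply/matrixP => i j; rewrite ord1 -colE !mxE.
have [->|->] := ord2 i => /=; first by rewrite w0E mulrNz mulrN.
exact: w1E.
Qed.

(** [U' *m invmx U] takes the first column of [U] to that of [U'], hence [w] to
    a positive multiple of [w']. *)
Lemma rational_flows_automorphism (w w' : 'cV[R]_2) :
  w != 0 -> w' != 0 -> rational_vec w -> rational_vec w' ->
  exists (alpha : R -> R) (h : S 2 -> S 2), sol_automorphism h /\
    flow_equivalence (linear_flow (scalar_seq 2 P) w)
                     (linear_flow (scalar_seq 2 P) w') alpha h.
Proof.
move=> w0 w'0 wrat w'rat.
have [U [c [Uu c0 wE]]] := rational_vec_unimodular w0 wrat.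
have [U' [c' [U'u c'0 w'E]]] := rational_vec_unimodular w'0 w'rat.
have Lu : U' *m invmx U \in unitmx by rewrite unitmx_mul U'u unitmx_inv.
have hauto := sol_map_automorphism Lu.
exists (fun t => c / c' * t), (sol_map (U' *m invmx U)); split=> //; split.
- by apply: scaling_increasing_hom; rewrite divr_gt0.
- by case: hauto.
move=> t x; rewrite /linear_flow; case: hauto => -> _; congr (_ + _).
rewrite sol_map_pi; congr sol_pi.
rewrite wE w'E -!scalemxAr !scalerA mulmxA -map_mxM -mulmxA mulVmx // mulmx1.
by congr (_ *: _); rewrite mulrAC divfK ?gt_eqF // mulrC.
Qed.

(** Irrationality of one of the two vectors suffices to straighten the given
    equivalence, up to inverting it; otherwise both are rational. *)
Lemma equivalent_flows_automorphism (w w' : 'cV[R]_2) :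
  w != 0 -> w' != 0 ->
  flows_equivalent (linear_flow (scalar_seq 2 P) w)
                   (linear_flow (scalar_seq 2 P) w') ->
  exists (alpha : R -> R) (h : S 2 -> S 2), sol_automorphism h /\
    flow_equivalence (linear_flow (scalar_seq 2 P) w)
                     (linear_flow (scalar_seq 2 P) w') alpha h.
Proof.
move=> w0 w'0 [alpha [h fe]].
have [wirr|wrat] := pselect (irrational_vec w).
  have [kauto kfe] := irrational_flow_equivalence_automorphism wirr fe.
  by exists alpha, (fun x => h x - h 0).
have [w'irr|w'rat] := pselect (irrational_vec w').
  have [beta [g [gfe _ _]]] := flow_equivalence_sym fe.
  have [kauto kfe] := irrational_flow_equivalence_automorphism w'irr gfe.
  have [gamma [l [lfe kl lk]]] := flow_equivalence_sym kfe.
  by exists gamma, l; split=> //; exact: sol_automorphism_inv kauto kl lk.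
exact: rational_flows_automorphism.
Qed.

End Flows.

Theorem corollary9 (R : realType) (P : nonzero_seq) (hP : properly_arranged P) :
  (forall w w' : 'cV[R]_2, w != 0 -> w' != 0 ->
    flows_equivalent (linear_flow (scalar_seq 2 P) w)
                     (linear_flow (scalar_seq 2 P) w') ->
    exists A : 'M[R]_2,
      [/\ A \in unitmx,
          forall i j, proper_multiplier P P (A i j) /\
                      proper_multiplier P P (invmx A i j) &
          exists h : solenoid R (scalar_seq 2 P) -> solenoid R (scalar_seq 2 P),
            represents_automorphism A h /\
            exists alpha : R -> R,
              flow_equivalence (linear_flow (scalar_seq 2 P) w)
                               (linear_flow (scalar_seq 2 P) w') alpha h]) /\
  (forall w w' : 'cV[R]_2, w != 0 -> w' != 0 ->
    rational_vec w -> rational_vec w' ->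
    flows_equivalent (linear_flow (scalar_seq 2 P) w)
                     (linear_flow (scalar_seq 2 P) w')).
Proof.
split=> w w' w0 w'0.
  move=> /(equivalent_flows_automorphism w0 w'0)[alpha [h [hauto hfe]]].
  have [A [Au Amult Ah]] := sol_automorphism_matrix hauto.
  by exists A; split=> //; exists h; split=> //; exists alpha.
move=> wrat w'rat.
have [alpha [h [_ hfe]]] :=
  rational_flows_automorphism (P := P) w0 w'0 wrat w'rat.
by exists alpha, h.
Qed.
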